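(* The class of $(2P_2,\overline{P_5},\overline{3P_2})$-free atoms has unbounded clique-width.
   Context: Graphs are finite, simple and undirected. A graph $G$ is $(H_1,\dots,H_p)$-free if it contains none of $H_1,\dots,H_p$ as an induced subgraph. A clique $K\subseteq V(G)$ (possibly empty) is a clique cut-set of $G$ if $G\setminus K$ is disconnected; an atom is a graph with no clique cut-set (so atoms are connected). $P_t$ is the path on $t$ vertices, $rG$ is the disjoint union of $r$ copies of $G$, and $\overline{G}$ is the complement of $G$. The clique-width $\mathrm{cw}(G)$ is the minimum number of labels needed to construct $G$ using four operations: create a new graph consisting of a single vertex with label $i$; take the disjoint union of two labelled graphs; add an edge between every vertex with label $i$ and every vertex with label $j$ ($i\ne j$); relabel every vertex with label $i$ to have label $j$. A class of graphs has bounded clique-width if there is a constant $c$ with $\mathrm{cw}(G)\le c$ for every $G$ in the class; otherwise its clique-width is unbounded. *)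

(* Defs.v *)
From mathcomp Require Import all_boot.
From mathcomp Require Import boolp.
From Stdlib Require List.

Set Implicit Arguments.
Unset Strict Implicit.
Unset Printing Implicit Defensive.

Record sgraph := SGraph {
  vertex :> finType;
  adj : rel vertex;
  adj_sym : symmetric adj;
  adj_irr : irreflexive adj }.

Definition isomorphic (G H : sgraph) : Prop :=
  exists2 f : G -> H, bijective f & forall x y, adj (f x) (f y) = adj x y.

Section Constructions.

Variable G : sgraph.

Definition induced_adj (A : {set G}) : rel {x : G | x \in A} :=
  fun x y => adj (val x) (val y).

Fact induced_sym A : symmetric (@induced_adj A).
Proof. by move=> x y; rewrite /induced_adj adj_sym. Qed.

Fact induced_irr A : irreflexive (@induced_adj A).
Proof. by move=> x; rewrite /induced_adj adj_irr. Qed.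

Definition induced (A : {set G}) : sgraph :=
  SGraph (@induced_sym A) (@induced_irr A).

Definition compl_adj : rel G := fun x y => (x != y) && ~~ adj x y.

Fact compl_sym : symmetric compl_adj.
Proof. by move=> x y; rewrite /compl_adj eq_sym adj_sym. Qed.

Fact compl_irr : irreflexive compl_adj.
Proof. by move=> x; rewrite /compl_adj eqxx. Qed.

Definition compl : sgraph := SGraph compl_sym compl_irr.

Definition copies_adj r : rel ('I_r * G) :=
  fun x y => (x.1 == y.1) && adj x.2 y.2.

Fact copies_sym r : symmetric (@copies_adj r).
Proof. by move=> x y; rewrite /copies_adj eq_sym adj_sym. Qed.

Fact copies_irr r : irreflexive (@copies_adj r).
Proof. by move=> x; rewrite /copies_adj adj_irr andbF. Qed.

(* The disjoint union of [r] copies of [G]. *)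
Definition copies r : sgraph := SGraph (@copies_sym r) (@copies_irr r).

End Constructions.

Definition path_adj t : rel 'I_t := fun i j => (i.+1 == j) || (j.+1 == i).

Fact path_sym t : symmetric (@path_adj t).
Proof. by move=> i j; rewrite /path_adj orbC. Qed.

Fact path_irr t : irreflexive (@path_adj t).
Proof. by move=> i; rewrite /path_adj orbb gtn_eqF. Qed.

(* The path on [t] vertices (not [t] edges). *)
Definition path_graph t : sgraph := SGraph (@path_sym t) (@path_irr t).

Definition contains_induced (G H : sgraph) : Prop :=
  exists A : {set G}, isomorphic (induced A) H.

Definition free (Hs : seq sgraph) (G : sgraph) : Prop :=
  forall H, List.In H Hs -> ~ contains_induced G H.

(* The graph without vertices counts as connected, so deleting all the
   vertices of a complete graph does not disconnect it. *)
Definition connected (G : sgraph) : Prop := forall x y : G, connect (@adj G) x y.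

Definition clique (G : sgraph) (K : {set G}) : Prop :=
  {in K &, forall x y, x != y -> adj x y}.

Definition clique_cutset (G : sgraph) (K : {set G}) : Prop :=
  clique K /\ ~ connected (induced (~: K)).

Definition atom (G : sgraph) : Prop := ~ exists K : {set G}, clique_cutset K.

Record lgraph (k : nat) := LGraph {
  lgraph_graph :> sgraph;
  label : lgraph_graph -> 'I_k }.

Section Operations.

Variable k : nat.

Fact single_sym : symmetric (fun _ _ : unit => false). Proof. by []. Qed.
Fact single_irr : irreflexive (fun _ _ : unit => false). Proof. by []. Qed.

Definition lsingle (i : 'I_k) : lgraph k :=
  @LGraph k (SGraph single_sym single_irr) (fun _ => i).

Definition union_adj (G H : sgraph) : rel (G + H) := fun x y =>
  match x, y with
  | inl u, inl v => adj u v
  | inr u, inr v => adj u v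
  | _, _ => false
  end.

Fact union_sym G H : symmetric (@union_adj G H).
Proof. by move=> [x|x] [y|y] //=; rewrite adj_sym. Qed.

Fact union_irr G H : irreflexive (@union_adj G H).
Proof. by move=> [x|x] /=; rewrite adj_irr. Qed.

Definition lunion (L M : lgraph k) : lgraph k :=
  @LGraph k (SGraph (@union_sym L M) (@union_irr L M))
    (fun x => match x with inl u => label u | inr v => label v end).

Definition join_adj (i j : 'I_k) (L : lgraph k) : rel L := fun x y =>
  [|| adj x y, (label x == i) && (label y == j)
    | (label x == j) && (label y == i)].

Fact join_sym i j L : symmetric (@join_adj i j L).
Proof.
move=> x y; rewrite /join_adj adj_sym; congr (_ || _).
by rewrite orbC ![_ && (label y == _)]andbC.
Qed.

Fact join_irr i j (ij : i != j) L : irreflexive (@join_adj i j L).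
Proof.
move=> x; rewrite /join_adj adj_irr /= [X in _ || X]andbC orbb.
by apply/negP => /andP[/eqP-> /eqP eij]; rewrite eij eqxx in ij.
Qed.

Definition ljoin i j (ij : i != j) (L : lgraph k) : lgraph k :=
  @LGraph k (SGraph (@join_sym i j L) (@join_irr i j ij L)) (@label k L).

Definition lrelabel (i j : 'I_k) (L : lgraph k) : lgraph k :=
  @LGraph k L (fun x => if label x == i then j else label x).

End Operations.

Inductive cwexpr (k : nat) : Type :=
  | Single of 'I_k
  | Union of cwexpr k & cwexpr k
  | Join (i j : 'I_k) of i != j & cwexpr k
  | Relabel of 'I_k & 'I_k & cwexpr k.

Fixpoint eval k (e : cwexpr k) : lgraph k :=
  match e with
  | Single i => lsingle i
  | Union e1 e2 => lunion (eval e1) (eval e2)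
  | Join i j ij e1 => ljoin ij (eval e1)
  | Relabel i j e1 => lrelabel i j (eval e1)
  end.

(* The four operations never produce the graph without vertices; it is taken
   to need no label, so that its presence in a class of graphs has no effect on
   the boundedness of the clique-width of the class. *)
Definition constructible (G : sgraph) (k : nat) : Prop :=
  #|G| = 0 \/ exists e : cwexpr k, isomorphic (eval e) G.

Section Existence.

Variable k : nat.

(* The expression builds, on distinct labels, exactly the label set [s] with
   adjacency [E] between labels. *)
Definition builds (s : seq 'I_k) (E : rel 'I_k) (e : cwexpr k) : Prop :=
  [/\ injective (@label k (eval e)),
      forall i, i \in s <-> exists v : eval e, label v = i
    & forall u v : eval e, adj u v = E (label u) (label v)].

Fact builds_edgeless i s : uniq (i :: s) ->
  exists e, builds (i :: s) (fun _ _ => false) e.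
Proof.
elim: s i => [|j s IHs] i.
  move=> _; exists (Single i); split=> //.
    by move=> [] [].
  by move=> j; rewrite inE; split=> [/eqP->|[_ <-] //]; exists tt.
rewrite cons_uniq => /andP[i_s /IHs[e [inj im noadj]]].
exists (Union (Single i) e); split.
- move=> [[]|u] [[]|v] //=.
  + by move=> eiv; case/negP: i_s; apply/im; exists v.
  + by move=> eui; case/negP: i_s; apply/im; exists u.
  + by move/inj->.
- move=> l; rewrite inE; split.
    by case/orP=> [/eqP->|/im[v <-]]; [exists (inl tt) | exists (inr v)].
  move=> [[u|v] /= <-]; first by rewrite eqxx.
  by apply/orP; right; apply/im; exists v.
- by move=> [u|u] [v|v] //=; rewrite noadj.
Qed.

Fact builds_edges s E (p : seq ('I_k * 'I_k)) e : builds s E e ->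
  all (fun ij => ij.1 != ij.2) p ->
  exists e', builds s
    (fun i j => [|| E i j, (i, j) \in p | (j, i) \in p]) e'.
Proof.
move=> be; elim: p => [|[a b] p IHp] /=.
  move=> _; exists e; case: be => inj im adjE; split=> // u v.
  by rewrite adjE !in_nil !orbF.
case/andP=> ab /IHp[e' [inj im adjE]].
exists (Join ab e'); split=> // u v.
rewrite [LHS]/(join_adj _ _ _ _) /join_adj adjE !in_cons !xpair_eqE.
rewrite [(label v == a) && _]andbC.
move: (E _ _) ((_, _) \in p) ((_, _) \in p) => x y z.
move: (label u == a) (label v == b) (label v == a) (label u == b).
by case=> [] [] [] []; case: x; case: y; case: z.
Qed.

End Existence.

Fact constructible_card (G : sgraph) : constructible G #|G|.
Proof.
have [|G_gt0] := posnP #|G|; [by left | right].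
have [i [s [us ms]]] : exists i s, uniq (i :: s) /\ i :: s =i 'I_#|G|.
  have := mem_enum 'I_#|G|; have := enum_uniq 'I_#|G|.
  case: (enum _) => [_ /(_ (Ordinal G_gt0)) //|i s us ms].
  by exists i, s.
have [e0 be0] := builds_edgeless us.
pose p := [seq ij <- enum (('I_#|G| * 'I_#|G|)%type : finType) |
             adj (enum_val ij.1) (enum_val ij.2)].
have pE a b : ((a, b) \in p) = adj (enum_val a : G) (enum_val b).
  by rewrite mem_filter mem_enum andbT.
have loopless : all (fun ij => ij.1 != ij.2) p.
  apply/allP=> -[a b]; rewrite pE /=; case: eqP => // ->.
  by rewrite adj_irr.
have [e [inj im adjE]] := builds_edges be0 loopless.
exists e; exists (fun v => enum_val (label v)).
  apply: inj_card_bij => [u v /enum_val_inj/inj //|].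
  rewrite -[leqLHS]card_ord -(card_codom inj); apply: subset_leq_card.
  apply/subsetP=> a _; have /im[v <-] : a \in i :: s by rewrite ms.
  exact: codom_f.
by move=> u v; rewrite adjE /= !pE [X in _ || X]adj_sym orbb.
Qed.

Fact constructible_ex (G : sgraph) : exists k, `[< constructible G k >].
Proof. by exists #|G|; apply/asboolP; apply: constructible_card. Qed.

Definition cw (G : sgraph) : nat := ex_minn (constructible_ex G).

Definition bounded_cw (C : sgraph -> Prop) : Prop :=
  exists c : nat, forall G, C G -> cw G <= c.

Definition unbounded_cw (C : sgraph -> Prop) : Prop := ~ bounded_cw C.

(* Main.v *)
Require Import Defs.
From mathcomp Require Import all_boot.
From mathcomp Require Import boolp.
From mathcomp Require Import zify.

(** The graphs are split graphs to which two non-adjacent vertices, complete to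
    the rest, are added. In the complement this adds a disjoint edge to a split
    graph; split graphs are (2P_2, C_4)-free, so the complement is
    (C_4, P_5, 3P_2)-free. A clique misses one of the two added vertices, hence
    is not a cut-set as soon as the split graph is not complete.

    The split graph has a clique [K] of size [n] and one independent vertex for
    each subset of [K], joined to its elements. An expression with [k] labels
    has a subexpression whose vertex set [X] satisfies m < |X ∩ K| <= 2m, and
    the vertices of [X] have at most [k] distinct neighbourhoods outside [X].
    If k < m, two elements [a], [a'] of [X ∩ K] have the same one, so all pairs
    {a, b} with [b] in [K \ X] belong to [X]. These pairs are told apart by
    [K \ X], hence |K \ X| <= k, which fails for n = 3m. *)

Set Implicit Arguments.
Unset Strict Implicit.
Unset Printing Implicit Defensive.

(** * Balanced vertex sets in clique-width expressions *)

Definition few_types (k : nat) (G : sgraph) (X : {set G}) (l : G -> 'I_k) :=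
  {in X &, forall x x', l x = l x' ->
     forall y, y \notin X -> adj x y = adj x' y}.

Lemma card_set_sum (S T : finType) (W : {set S + T}) :
  #|W| = #|inl @^-1: W| + #|inr @^-1: W|.
Proof.
rewrite -!sum1_card big_sumType /=.
by congr (_ + _); apply: eq_bigl => x; rewrite inE.
Qed.

Lemma card_imsetI (S T : finType) (f : S -> T) (X : {set S}) (W : {set T}) :
  injective f -> #|(f @: X) :&: W| = #|X :&: f @^-1: W|.
Proof.
move=> f_inj; rewrite -(card_imset _ f_inj); apply: eq_card => y.
rewrite inE; apply/andP/imsetP => [[/imsetP[x xX ->] xW]|[x]].
  by exists x; rewrite // !inE xX.
by rewrite !inE => /andP[xX xW] ->; rewrite imset_f.
Qed.

(* The last conclusion is needed for the induction: the operations applied above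
   [X] then treat alike all vertices of the same type. *)
Lemma eval_balanced (k m : nat) (e : cwexpr k) (W : {set eval e}) :
  0 < m < #|W| ->
  exists (X : {set eval e}) (l : eval e -> 'I_k),
    [/\ m < #|X :&: W| <= m.*2, few_types X l
      & {in X &, forall x x', l x = l x' -> label x = label x'}].
Proof.
case/andP=> m_gt0; elim: e W => [i|e1 IH1 e2 IH2|i j ij e IH|i j e IH] W mW.
- have W1 : #|W| <= 1 by rewrite (leq_trans (max_card _)) // card_unit.
  by have := leq_trans mW W1; rewrite ltnS leqNgt m_gt0.
- have [mW1|W1m] := ltnP m #|inl @^-1: W|.
    have [X [l [cX tX lX]]] := IH1 _ mW1.
    exists (inl @: X : {set eval (Union e1 e2)}).
    exists (fun x => match x with inl u => l u | inr v => label v end).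
    split; first by rewrite card_imsetI //; apply: inl_inj.
      move=> _ _ /imsetP[x xX ->] /imsetP[x' x'X ->] /= lxx' [y|y] //=.
      by rewrite mem_imset; [apply: tX lxx' y | apply: inl_inj].
    by move=> _ _ /imsetP[x xX ->] /imsetP[x' x'X ->] /=; apply: lX.
  have [mW2|W2m] := ltnP m #|inr @^-1: W|.
    have [X [l [cX tX lX]]] := IH2 _ mW2.
    exists (inr @: X : {set eval (Union e1 e2)}).
    exists (fun x => match x with inl u => label u | inr v => l v end).
    split; first by rewrite card_imsetI //; apply: inr_inj.
      move=> _ _ /imsetP[x xX ->] /imsetP[x' x'X ->] /= lxx' [y|y] //=.
      by rewrite mem_imset; [apply: tX lxx' y | apply: inr_inj].
    by move=> _ _ /imsetP[x xX ->] /imsetP[x' x'X ->] /=; apply: lX.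
  (* Each side meets [W] in at most [m] elements, so the whole vertex set is balanced. Its types are
     the labels at this point; relabellings applied later may merge them, hence a separate [l]. *)
  exists setT, (@label k _); split=> //.
    by rewrite setTI mW card_set_sum -addnn leq_add.
  by move=> x x' _ _ _ y; rewrite inE.
- have [X [l [cX tX lX]]] := IH W mW.
  exists X, l; split=> // x x' xX x'X lxx' y yX /=.
  by rewrite /join_adj (tX x x') // (lX x x').
- have [X [l [cX tX lX]]] := IH W mW.
  by exists X, l; split=> // x x' xX x'X lxx' /=; rewrite (lX x x').
Qed.

Lemma constructible_balanced (k m : nat) (G : sgraph) (W : {set G}) :
  constructible G k -> 0 < m < #|W| ->
  exists (X : {set G}) (l : G -> 'I_k),
    m < #|X :&: W| <= m.*2 /\ few_types X l.
Proof.
move=> [G0|[e [f [g fK gK] f_adj]]] /[dup] mW /andP[m_gt0 m_W].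
  by have := leq_trans m_W (max_card (mem W)); rewrite G0.
have f_inj := can_inj fK; have g_inj := can_inj gK.
have cW : #|f @^-1: W| = #|W|.
  by apply: on_card_preimset; exists g => x _; rewrite ?fK ?gK.
have [|X [l [cX tX _]]] := @eval_balanced k m e (f @^-1: W); first by rewrite cW.
exists (f @: X), (l \o g); split; first by rewrite card_imsetI.
move=> _ _ /imsetP[x xX ->] /imsetP[x' x'X ->] /=; rewrite !fK => lxx' y.
by rewrite -[y]gK mem_imset // => /(tX x x' xX x'X lxx'); rewrite !f_adj.
Qed.

Lemma pigeonhole (T : finType) (k : nat) (A : {set T}) (f : T -> 'I_k) :
  k < #|A| -> exists x y, [/\ x \in A, y \in A, x != y & f x = f y].
Proof.
move=> kA; have /dinjectivePn[x xA [y]] : ~~ dinjectiveb f (mem A).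
  apply/dinjectiveP => /card_in_imset fA.
  by have := max_card (mem (f @: A)); rewrite fA card_ord leqNgt kA.
by rewrite !inE eq_sym => /andP[xy yA] fxy; exists x, y.
Qed.

(** * The split graph with two added vertices *)

Section SubsetGraph.

Variable n : nat.

(* [inl (inl i)] is a vertex of the clique, [inl (inr A)] is one of the
   independent set, and [inr b] is one of the two added vertices. *)
Definition subset_adj : rel ('I_n + {set 'I_n} + bool) := fun u v =>
  match u, v with
  | inl (inl i), inl (inl j) => i != j
  | inl (inl i), inl (inr A) | inl (inr A), inl (inl i) => i \in A
  | inl _, inr _ | inr _, inl _ => true
  | _, _ => false
  end.

Lemma subset_sym : symmetric subset_adj.
Proof. by move=> [[i|A]|b] [[j|B]|c] //=; rewrite eq_sym. Qed.

Lemma subset_irr : irreflexive subset_adj.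
Proof. by move=> [[i|A]|b] //=; rewrite eqxx. Qed.

Definition subset_graph : sgraph := SGraph subset_sym subset_irr.

Definition apex (u : subset_graph) : bool := if u is inr _ then true else false.

(** In the complement the two added vertices form a component, so being one of them spreads along
    non-edges. *)
Lemma apex_nonadj (u v : subset_graph) : ~~ adj u v -> apex u -> apex v.
Proof. by case: u v => [[i|A]|b] [[j|B]|c]. Qed.

Lemma nonapex_nonadj (u v : subset_graph) :
  ~~ adj u v -> ~~ apex u -> ~~ apex v.
Proof. by case: u v => [[i|A]|b] [[j|B]|c]. Qed.

Lemma apex_adjF (u v : subset_graph) : apex u -> apex v -> adj u v = false.
Proof. by case: u v => [[i|A]|b] [[j|B]|c]. Qed.

Definition indep (u : subset_graph) : bool :=
  if u is inl (inr _) then true else false.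

Lemma indep_adjF (u v : subset_graph) : indep u -> indep v -> adj u v = false.
Proof. by case: u v => [[i|A]|b] [[j|B]|c]. Qed.

Lemma nonadj_indep (u v : subset_graph) :
  u != v -> ~~ adj u v -> ~~ apex u -> indep u || indep v.
Proof.
case: u v => [[i|A]|b] [[j|B]|c] //= + /negPn/eqP ij.
by rewrite ij eqxx.
Qed.

(** The two non-adjacent pairs are the diagonals of an induced 4-cycle. Without apexes, each
    diagonal would contain an independent vertex, and these two would be adjacent. *)
Lemma subset_graph_C4 (a b c d : subset_graph) :
  a != b -> c != d -> ~~ adj a b -> ~~ adj c d ->
  [&& adj a c, adj a d, adj b c & adj b d] -> apex a || apex c.
Proof.
move=> ab cd nab ncd /and4P[ac ad bc bd].
apply/negPn/negP; rewrite negb_or => /andP[ua uc].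
have Ia := nonadj_indep ab nab ua; have Ic := nonadj_indep cd ncd uc.
case/orP: Ia => Iu; case/orP: Ic => Iv; have := indep_adjF Iu Iv;
  by rewrite ?ac ?ad ?bc ?bd.
Qed.

Definition core (u : subset_graph) : bool :=
  if u is inl (inl _) then true else false.

Lemma core_adj (u v : subset_graph) : core u -> core v -> adj u v = (u != v).
Proof. by case: u v => [[i|A]|b] [[j|B]|c]. Qed.

Lemma adj_core (u v : subset_graph) :
  adj u v -> ~~ apex u -> ~~ apex v -> core u || core v.
Proof. by case: u v => [[i|A]|b] [[j|B]|c]. Qed.

(** An apex among the four would make both ends of the other edge apexes, which are not adjacent. So
    each edge has an end in the clique, and two non-adjacent clique vertices coincide. *)
Lemma subset_graph_2P2 (a b c d : subset_graph) :
  adj a b -> adj c d -> ~~ [|| adj a c, adj a d, adj b c | adj b d] ->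
  [|| a == c, a == d, b == c | b == d].
Proof.
move=> ab cd; rewrite !negb_or => /and4P[ac ad bc bd].
have napex u : ~~ adj u c -> ~~ adj u d -> ~~ apex u.
  move=> uc ud; apply/negP => apu.
  by have := apex_adjF (apex_nonadj uc apu) (apex_nonadj ud apu); rewrite cd.
have ua := napex _ ac ad; have ub := napex _ bc bd.
have uc := nonapex_nonadj ac ua; have ud := nonapex_nonadj ad ua.
have core_eq u v : core u -> core v -> ~~ adj u v -> u == v.
  by move=> Cu Cv; rewrite core_adj // negbK.
by case/orP: (adj_core ab ua ub) => Cu; case/orP: (adj_core cd uc ud) => Cv;
  rewrite (core_eq _ _ Cu Cv) ?orbT.
Qed.

Lemma subset_graph_atom : 0 < n -> atom subset_graph.
Proof.
move=> n_gt0 [K [Kclique]]; apply.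
have [r ar rK] : exists2 r : subset_graph, apex r & r \in ~: K.
  have [tK|] := boolP (inr true \in K); last by exists (inr true); rewrite ?inE.
  exists (inr false) => //; rewrite inE; apply/negP => fK.
  by have := Kclique _ _ tK fK isT.
(* The independent vertices of the empty and the full subset are distinct as [n] is positive, so [K]
   misses one of them. *)
have [z az zK] : exists2 z : subset_graph, ~~ apex z & z \in ~: K.
  have [tK|] := boolP (inl (inr set0) \in K).
    exists (inl (inr setT)) => //; rewrite inE; apply/negP => fK.
    suff /(Kclique _ _ tK fK) :
      inl (inr set0) != inl (inr setT) :> subset_graph by [].
    by apply/eqP => -[] /setP /(_ (Ordinal n_gt0)); rewrite !inE.
  by exists (inl (inr set0)); rewrite ?inE.
have conS : connect_sym (@adj (induced (~: K))).
  exact/sym_connect_sym/adj_sym.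
pose r' : induced (~: K) := exist _ r rK.
pose z' : induced (~: K) := exist _ z zK.
have apex_adj (u v : subset_graph) : apex u -> ~~ apex v -> adj u v.
  by case: u v => [[i|A]|b] [[j|B]|c].
have con_r (x : induced (~: K)) : connect (@adj (induced (~: K))) r' x.
  have [ax|nax] := boolP (apex (val x)).
    (* Two apexes are not adjacent; they are linked through [z']. *)
    apply: (@connect_trans _ _ z'); first by apply/connect1/apex_adj.
    by rewrite conS; apply/connect1/apex_adj.
  exact/connect1/apex_adj.
by move=> x y; apply: (@connect_trans _ _ r'); rewrite // conS.
Qed.

Lemma subset_graph_constructible (k m : nat) :
  k < m -> m.*2 + m <= n -> ~ constructible subset_graph k.
Proof.
move=> km mn cG; pose f (i : 'I_n) : subset_graph := inl (inl i).
have f_inj : injective f by move=> i j [].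
have [|X [l [/andP[mX Xm] tX]]] :=
    @constructible_balanced k m _ (f @: setT) cG.
  by rewrite card_imset // cardsT card_ord; lia.
rewrite setIC card_imsetI // setTI in mX Xm.
have [a [a' [aX a'X aa' laa']]] := pigeonhole (l \o f) (ltn_trans km mX).
rewrite !inE in aX a'X.
(* At least [n - 2m >= m] clique vertices lie outside [X]. *)
have kB : k < #|~: (f @^-1: X)| by rewrite cardsCs setCK card_ord; lia.
pose pair b : subset_graph := inl (inr [set a; b]).
have pairX b : f b \notin X -> pair b \in X.
  (* Outside [X], [pair b] would be adjacent to [f a'] as it is to [f a], so [a' = b], although
     [f b] is not in [X]. *)
  move=> bX; apply/negPn/negP => /(tX _ _ aX a'X laa') /=.
  rewrite !inE eqxx [a' == a]eq_sym (negPf aa') /= => /esym/eqP a'b.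
  by rewrite -a'b a'X in bX.
have [b [b' [+ + bb' lbb']]] := pigeonhole (l \o pair) kB.
rewrite !inE => bX b'X.
(* Being adjacent to [pair b], [f b] is adjacent to [pair b'] too, which forces [b = a]. *)
have := tX _ _ (pairX b bX) (pairX b' b'X) lbb' _ bX.
rewrite /= !inE eqxx orbT (negPf bb') orbF => /esym/eqP ba.
by rewrite ba aX in bX.
Qed.

End SubsetGraph.

(** * The forbidden induced subgraphs *)

Lemma contains_inducedP (G H : sgraph) : contains_induced G H ->
  exists g : H -> G, injective g /\ forall x y, adj (g x) (g y) = adj x y.
Proof.
move=> [A [f [g fK gK] f_adj]]; exists (val \o g); split.
  exact: inj_comp val_inj (can_inj gK).
by move=> x y; rewrite -[in RHS](gK x) -[in RHS](gK y) f_adj.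
Qed.

Section Free.

Variable n : nat.

Lemma subset_graph_2P2_free :
  ~ contains_induced (subset_graph n) (copies (path_graph 2) 2).
Proof.
move=> /contains_inducedP[g [g_inj g_adj]].
pose v i j : copies (path_graph 2) 2 := (inord i, inord j).
have := @subset_graph_2P2 n (g (v 0 0)) (g (v 0 1)) (g (v 1 0)) (g (v 1 1)).
rewrite !g_adj !(inj_eq g_inj) /= /copies_adj /= /path_adj.
by rewrite !xpair_eqE -!val_eqE /= !inordK //; do 3!move/(_ isT).
Qed.

Lemma subset_graph_coP5_free :
  ~ contains_induced (subset_graph n) (compl (path_graph 5)).
Proof.
move=> /contains_inducedP[g [g_inj g_adj]].
have adjE i j : i < 5 -> j < 5 ->
    adj (g (inord i)) (g (inord j)) = [&& i != j, i.+1 != j & j.+1 != i].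
  move=> i5 j5.
  by rewrite g_adj /= /compl_adj /= /path_adj -val_eqE /= !inordK // negb_or.
have neqE i j : i < 5 -> j < 5 ->
    (g (inord i) != g (inord j)) = (i != j).
  by move=> i5 j5; rewrite (inj_eq g_inj) -val_eqE /= !inordK.
(* An apex would spread along the path to two further vertices, but the ends of three consecutive
   ones are adjacent in the complement of the path. *)
have step i : i.+2 < 5 -> ~~ apex (g (inord i)).
  move=> i5; apply/negP => ai; have j5 := ltnW i5; have k5 := ltnW j5.
  have aj : apex (g (inord i.+1)).
    by apply: apex_nonadj ai; rewrite adjE //; lia.
  have ak : apex (g (inord i.+2)).
    by apply: apex_nonadj aj; rewrite adjE //; lia.
  by have := apex_adjF ai ak; rewrite adjE //; lia.
(* The first and last edges of the path are the diagonals of an induced 4-cycle. *)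
have /orP[a0|a3] : apex (g (inord 0)) || apex (g (inord 3)).
  by apply: (@subset_graph_C4 n _ (g (inord 1)) _ (g (inord 4)));
    rewrite ?neqE ?adjE.
  by have := step 0 isT; rewrite a0.
(* [step] stops at index 2, so the apex at 3 is first moved back to 2. *)
have := step 2 isT; rewrite (apex_nonadj _ a3) //.
by rewrite adjE.
Qed.

(** Any two of the three non-adjacent pairs span a 4-cycle, so at least two of the vertices [v i 0]
    are apexes; yet these vertices are pairwise adjacent. *)
Lemma subset_graph_co3P2_free :
  ~ contains_induced (subset_graph n) (compl (copies (path_graph 2) 3)).
Proof.
move=> /contains_inducedP[g [g_inj g_adj]].
pose v i j := g (inord i, inord j).
have adjE i j i' j' : i < 3 -> i' < 3 -> j < 2 -> j' < 2 ->
    adj (v i j) (v i' j') = (i != i').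
  move=> i3 i'3 j2 j'2; rewrite g_adj /= /compl_adj /= /copies_adj /= /path_adj.
  rewrite xpair_eqE -!val_eqE /= !inordK //.
  by case: eqVneq => //= _; lia.
have neqE i : i < 3 -> v i 0 != v i 1.
  by move=> i3; rewrite (inj_eq g_inj) xpair_eqE -!val_eqE /= !inordK // andbF.
have one i j : i < 3 -> j < 3 -> i != j -> apex (v i 0) || apex (v j 0).
  move=> i3 j3 ij.
  by apply: (@subset_graph_C4 n _ (v i 1) _ (v j 1));
    rewrite ?neqE // !adjE // ?eqxx // ij.
have two i j : i < 3 -> j < 3 -> i != j -> ~~ (apex (v i 0) && apex (v j 0)).
  move=> i3 j3 ij; apply/negP => /andP[ai aj].
  by have := apex_adjF ai aj; rewrite adjE // ij.
have := one 0 1 isT isT isT; have := one 0 2 isT isT isT.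
have := one 1 2 isT isT isT; have := two 0 1 isT isT isT.
have := two 0 2 isT isT isT; have := two 1 2 isT isT isT.
by case: (apex (v 0 0)); case: (apex (v 1 0)); case: (apex (v 2 0)).
Qed.

End Free.

Theorem lemma28 :
  unbounded_cw (fun G : sgraph =>
    free [:: copies (path_graph 2) 2;
             compl (path_graph 5);
             compl (copies (path_graph 2) 3)] G
    /\ atom G).
Proof.
(* This is [n = 3m] for [m = c + 1], which exceeds any number of labels up to [c]. *)
move=> [c cw_le]; pose n := c.+1.*2 + c.+1.
have /cw_le : free [:: copies (path_graph 2) 2; compl (path_graph 5);
    compl (copies (path_graph 2) 3)] (subset_graph n) /\ atom (subset_graph n).
  split; last exact: subset_graph_atom.
  move=> H [<-|[<-|[<-|[]]]].
  - exact: subset_graph_2P2_free.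
  - exact: subset_graph_coP5_free.
  - exact: subset_graph_co3P2_free.
rewrite /cw; case: ex_minnP => k /asboolP cGk _ kc.
exact: (@subset_graph_constructible n k c.+1) cGk.
Qed.
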